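(* For $\ell\ge2$, the number of ideals (downward-closed subsets, including the empty set) of the D-vine of dimension $\ell-1$ equals the $\ell$-th Catalan number $\mathrm{Cat}_\ell=\frac{1}{\ell+1}\binom{2\ell}{\ell}=\prod_{k=2}^{\ell}\frac{\ell+k}{k}$.
   Context: Posets are finite. A graded poset has a rank function $\operatorname{rk}\colon\mathcal{P}\to\mathbb{Z}_{>0}$ with $x<y\Rightarrow\operatorname{rk}(x)<\operatorname{rk}(y)$, $\operatorname{rk}(y)=\operatorname{rk}(x)+1$ when $y$ covers $x$, and all minimal elements of rank $1$; $\mathcal{P}_i$ = elements of rank $i$, $\dim(\mathcal{P})$ = number of minimal elements, $\mathcal{E}(v)$ = elements covered by $v$. A vine is a graded poset in which every non-minimal element covers exactly two elements, any two distinct elements of the same rank are covered by at most one common element, and for each $1\le i\le\operatorname{rk}(\mathcal{P})$ the graph $F_i$ (the $i$-th associated forest) on $\mathcal{P}_i$ with edge set $\{\mathcal{E}(v)\mid v\in\mathcal{P}_{i+1}\}$ is a forest. An R-vine is a vine with $\operatorname{rk}(\mathcal{P})=\dim(\mathcal{P})$, each $F_i$ a tree, and proximity: distinct elements of the same rank $i\ge2$ covered by a common element cover a common element. A D-vine is an R-vine each of whose associated trees $F_i$ is a path graph. (All D-vines of a given dimension are isomorphic as posets.) *)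

(* Defs.v *)
From mathcomp Require Import all_boot all_order all_algebra.

Set Implicit Arguments.
Unset Strict Implicit.
Unset Printing Implicit Defensive.

Import Order.Theory.

(* A finite simple graph on vertices of a finType is given by a vertex set V
   and an edge set E of 2-element subsets of V. *)
Section Graphs.
Variable T : finType.
Implicit Types (V : {set T}) (E : {set {set T}}).

Definition adj E : rel T := fun x y => (x != y) && ([set x; y] \in E).

Definition is_forest E : Prop :=
  forall c : seq T, 2 < size c -> ~ ucycle (adj E) c.

Definition is_tree V E : Prop :=
  [/\ V != set0, is_forest E & {in V &, forall x y, connect (adj E) x y}].

(* The vertices can be listed without repetition as x, p_1, ..., p_m so that
   the edges are exactly the pairs of consecutive vertices in the list. *)
Definition is_path_graph V E : Prop :=
  exists (x : T) (p : seq T),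
    [/\ uniq (x :: p),
        V = [set:: x :: p] &
        E = [set:: pairmap (fun y z => [set y; z]) x p]].

End Graphs.

Section Vines.
Context {d : Order.disp_t} (T : finPOrderType d).
Implicit Types (x y z v w : T) (i : nat).

Definition covers y x : bool :=
  (x < y)%O && [forall z, ~~ ((x < z)%O && (z < y)%O)].

Definition minimal x : bool := [forall y, ~~ (y < x)%O].

Definition dimension : nat := #|[set x | minimal x]|.

Definition covered_by v : {set T} := [set x | covers v x].

Definition is_ideal (I : {set T}) : bool :=
  [forall x in I, forall y, (y <= x)%O ==> (y \in I)].

Definition ideals : {set {set T}} := [set I | is_ideal I].

Variable rk : T -> nat.

Definition is_rank_function : Prop :=
  [/\ forall x, 0 < rk x,
      forall x y, (x < y)%O -> rk x < rk y,
      forall x y, covers y x -> rk y = (rk x).+1 &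
      forall x, minimal x -> rk x = 1].

Definition poset_rank : nat := \max_x rk x.

Definition level i : {set T} := [set x | rk x == i].

(* The graph F_i is (level i, forest_edges i). *)
Definition forest_edges i : {set {set T}} :=
  [set covered_by v | v in level i.+1].

Definition is_vine : Prop :=
  [/\ is_rank_function,
      forall v, ~~ minimal v -> #|covered_by v| = 2,
      forall x y, x != y -> rk x = rk y ->
        forall v w, covers v x -> covers v y -> covers w x -> covers w y ->
        v = w &
      forall i, 1 <= i <= poset_rank -> is_forest (forest_edges i)].

Definition proximity : Prop :=
  forall x y, x != y -> rk x = rk y -> 2 <= rk x ->
    (exists v, covers v x && covers v y) ->
    exists w, covers x w && covers y w.

Definition is_R_vine : Prop :=
  [/\ is_vine,
      poset_rank = dimension,
      forall i, 1 <= i <= poset_rank -> is_tree (level i) (forest_edges i) &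
      proximity].

Definition is_D_vine : Prop :=
  is_R_vine /\
  forall i, 1 <= i <= poset_rank -> is_path_graph (level i) (forest_edges i).

End Vines.

Section Catalan.
Import GRing.Theory.
Local Open Scope ring_scope.

Definition catalan (l : nat) : rat := 1 / l.+1%:R * 'C((2 * l)%N, l)%:R.

End Catalan.

(* Main.v *)
Require Import Defs.
From mathcomp Require Import all_boot all_order all_algebra zify.

(* A D-vine of dimension n is the triangle of points (i, p) with i <= p < n,
   where (i+1, p+1) covers (i, p) and (i, p+1): each path F_i lists the points
   of one row, and proximity forces the path on the next row to follow the order
   of its consecutive pairs.  An ideal meets each chain {(i, p) | i <= p} in an
   initial segment of some length h(p), and is determined by h; the sequences
   that arise are those with h(0) <= 1 and h(p+1) <= h(p) + 1.  These are counted
   by a ballot recursion, whose solution is the Catalan number Cat_(n+1). *)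

Set Implicit Arguments.
Unset Strict Implicit.
Unset Printing Implicit Defensive.

(** * Counting sequences that grow by at most one *)

Definition slow : rel nat := fun a b => b <= a.+1.

(** The argument [a] stands for the entry preceding the list; [a = 0] encodes the bound h(0) <=
    1. *)
Fixpoint slow_seqs (k a : nat) : seq (seq nat) :=
  if k is k'.+1 then [seq b :: s | b <- iota 0 a.+2, s <- slow_seqs k' b]
  else [:: [::]].
Arguments slow_seqs : simpl never.

Lemma slow_seqsS k a :
  slow_seqs k.+1 a = [seq b :: s | b <- iota 0 a.+2, s <- slow_seqs k b].
Proof. by []. Qed.

Lemma slow_seqs_uniq k a : uniq (slow_seqs k a).
Proof.
elim: k a => [|k IHk] a //; rewrite slow_seqsS.
apply: (@allpairs_uniq_dep _ _ _ cons (iota 0 a.+2) (slow_seqs k)).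
- exact: iota_uniq.
- by move=> b _; apply: IHk.
by move=> [b s] [c t] _ _ /= [-> ->].
Qed.

Lemma mem_slow_seqs k a s :
  (s \in slow_seqs k a) = (size s == k) && path slow a s.
Proof.
elim: k a s => [|k IHk] a s; first by case: s.
rewrite slow_seqsS; case: s => [|b s]; first by apply/allpairsPdep => -[? [? []]].
rewrite eqSS; apply/allpairsPdep/and3P => /=.
  move=> [c [t [+ + [-> ->]]]].
  by rewrite (mem_iota 0 a.+2) ltnS IHk => le_ca /andP[sz_t path_t].
move=> [sz_s le_ba path_s]; exists b, s.
by rewrite (mem_iota 0 a.+2) ltnS IHk sz_s.
Qed.

Lemma size_slow_seqsS k a :
  size (slow_seqs k.+1 a) = \sum_(0 <= b < a.+2) size (slow_seqs k b).
Proof.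
by rewrite slow_seqsS size_allpairs_dep sumnE big_map.
Qed.

(* The ballot formula from the reflection principle, written without subtraction. *)
Lemma size_slow_seqs_reflection k a :
  size (slow_seqs k.+1 a) + 'C(2 * k + a + 3, k) = 'C(2 * k + a + 3, k.+1).
Proof.
elim: k a => [|k IHk] a.
  rewrite size_slow_seqsS sum_nat_const_nat bin0 bin1 /=; lia.
elim: a => [|a IHa].
  rewrite size_slow_seqsS big_nat_recr ?big_nat1 //=.
  have := IHk 0; have := IHk 1.
  have -> : 2 * k.+1 + 0 + 3 = (2 * k + 1 + 3).+1 by lia.
  have -> : 2 * k + 1 + 3 = (2 * k + 0 + 3).+1 by lia.
  rewrite !binS.
  (* Symmetry of binomials: k+2 and k+1 add up to 2k+3. *)
  have -> : 'C(2 * k + 0 + 3, k.+2) = 'C(2 * k + 0 + 3, k.+1).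
    by rewrite -bin_sub; [congr 'C(_, _); lia | lia].
  lia.
(* Splitting off the largest first entry [a.+2] leaves the count for [a]; Pascal's rule does the
   rest. *)
rewrite size_slow_seqsS big_nat_recr //= -size_slow_seqsS.
have := IHk a.+2.
have -> : 2 * k.+1 + a.+1 + 3 = (2 * k + a.+2 + 3).+1 by lia.
move: IHa; have -> : 2 * k.+1 + a + 3 = 2 * k + a.+2 + 3 by lia.
rewrite !binS; lia.
Qed.

(** For n = k+1, reflection gives the count C(2k+3, k+1) - C(2k+3, k). The ratio of these two
    binomials is known, and twice the first is the central binomial. *)
Lemma size_slow_seqs_catalan n :
  n.+2 * size (slow_seqs n 0) = 'C(2 * n.+1, n.+1).
Proof.
case: n => [|k] //.
have := size_slow_seqs_reflection k 0.
have := mul_bin_left (2 * k + 3) k.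
have -> : 2 * k.+2 = (2 * k + 3).+1 by lia.
rewrite addn0 binS.
have -> : 'C(2 * k + 3, k.+2) = 'C(2 * k + 3, k.+1).
  by rewrite -bin_sub; [congr 'C(_, _); lia | lia].
have -> : 2 * k + 3 - k = k + 3 by lia.
move: ('C(_, k)) ('C(_, _)) (size _) => x y z; nia.
Qed.

(** * Closed subsets of a triangle *)

(** Downward closure makes [a] hold exactly before its first failure; [find] returns [m] when
    nothing fails. *)
Lemma lt_find_down_closed (a : pred nat) m i :
    (forall j, j.+1 < m -> a j.+1 -> a j) -> i < m ->
  (i < find (predC a) (iota 0 m)) = a i.
Proof.
move=> a_down lt_im; apply/idP/idP => [/(before_find 0)/negbFE|ai].
  by rewrite nth_iota.
rewrite ltnNge; apply/negP => le_fi.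
set f := find _ _ in le_fi; have /(nth_find 0) : has (predC a) (iota 0 m).
  by rewrite has_find size_iota (leq_ltn_trans le_fi).
rewrite -/f nth_iota ?(leq_ltn_trans le_fi) //= add0n => /negP; apply.
(* Descending from [i] to the first failure [f] would make [a] hold at [f]. *)
elim: i le_fi ai lt_im => [|i IHi]; first by rewrite leqn0 => /eqP->.
rewrite leq_eqVlt => /predU1P[-> //|le_fi ai lt_im].
exact: IHi le_fi (a_down i lt_im ai) (ltnW lt_im).
Qed.

Section Triangle.
Variables (T : finType) (n : nat) (e : nat -> nat -> T).
Hypothesis e_inj : forall i p i' p', i <= p < n -> i' <= p' < n ->
  e i p = e i' p' -> i = i' /\ p = p'.
Hypothesis e_surj : forall x, exists i p, i <= p < n /\ x = e i p.

Definition triangle_closed (I : {set T}) : Prop :=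
  forall i p, i <= p -> p.+1 < n -> e i.+1 p.+1 \in I ->
  (e i p \in I) && (e i p.+1 \in I).

Definition height (I : {set T}) p : nat :=
  find (predC (fun i => e i p \in I)) (iota 0 p.+1).

Lemma height_le I p : height I p <= p.+1.
Proof. by rewrite -[leqRHS](size_iota 0) find_size. Qed.

Lemma lt_height I i p :
  triangle_closed I -> i <= p < n -> (i < height I p) = (e i p \in I).
Proof.
move=> clI /andP[le_ip lt_pn].
apply: (@lt_find_down_closed (fun i => e i p \in I)) => // j lt_jp.
case: p lt_jp lt_pn {le_ip} => // p lt_jp lt_pn eI.
by have /andP[] := clI j p lt_jp lt_pn eI.
Qed.

(** Column 0 has a single point. If column p+1 has height i+1 with i > 0, its top point [e i p.+1]
    forces [e i.-1 p] into [I], so column p has height at least i. *)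
Lemma height_slow I :
  triangle_closed I -> path slow 0 (mkseq (height I) n).
Proof.
move=> clI; apply/(pathP 0) => i; rewrite size_mkseq => lt_in.
rewrite nth_mkseq //; case: i lt_in => [|p] lt_pn; first exact: height_le.
rewrite /= nth_mkseq ?(ltnW lt_pn) // /slow.
case def_h: (height I p.+1) => [|i] //; rewrite ltnS.
have le_ip : i <= p.+1 by rewrite -ltnS -def_h height_le.
have eI : e i p.+1 \in I by rewrite -lt_height ?le_ip ?def_h.
case: i le_ip eI {def_h} => // i le_ip eI.
have /andP[] := clI i p le_ip lt_pn eI.
by rewrite -lt_height // -ltnS le_ip ltnW.
Qed.

Lemma height_inj I J : triangle_closed I -> triangle_closed J ->
  mkseq (height I) n = mkseq (height J) n -> I = J.
Proof.
move=> clI clJ eqIJ; apply/setP => x; have [i [p [lt_ip ->]]] := e_surj x.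
have /andP[_ lt_pn] := lt_ip.
rewrite -!lt_height // -[height I p](nth_mkseq 0 _ lt_pn) eqIJ.
by rewrite nth_mkseq.
Qed.

(** The inverse of the height map: column p is filled up to level [nth 0 s p]. *)
Definition under (s : seq nat) : {set T} :=
  [set x | [exists p : 'I_n, [exists i : 'I_n,
     [&& i <= p, i < nth 0 s p & x == e i p]]]].

Lemma mem_under s i p : i <= p < n -> (e i p \in under s) = (i < nth 0 s p).
Proof.
move=> /andP[le_ip lt_pn]; rewrite inE; apply/existsP/idP.
  move=> [p' /existsP[i' /and3P[le_ip' lt_is /eqP e_eq]]].
  by have [||-> ->] := e_inj _ _ e_eq; rewrite ?le_ip ?le_ip' /=.
move=> lt_is; exists (Ordinal lt_pn); apply/existsP.
by exists (Ordinal (leq_ltn_trans le_ip lt_pn)); rewrite /= le_ip lt_is eqxx.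
Qed.

(** Ensures that the prescribed heights fit into the columns, so [under] truncates nothing. *)
Lemma slow_nth_le s p : path slow 0 s -> nth 0 s p <= p.+1.
Proof.
move=> slow_s; have [le_sp|] := leqP (size s) p; first by rewrite nth_default.
elim: p => [|p IHp] lt_ps; have := pathP 0 slow_s _ lt_ps; rewrite /slow //=.
by move/leq_trans; apply; rewrite ltnS IHp // ltnW.
Qed.

Lemma under_closed s : size s = n -> path slow 0 s -> triangle_closed (under s).
Proof.
move=> sz_s slow_s i p le_ip lt_pn.
have le_ip1 : i <= p.+1 by apply: leqW.
have := pathP 0 slow_s p.+1; rewrite sz_s /= /slow => /(_ lt_pn) le_s.
rewrite !mem_under ?ltnS ?le_ip ?lt_pn ?(ltnW lt_pn) ?le_ip1 // => lt_is.
by rewrite (ltnW lt_is) andbT -ltnS (leq_trans lt_is).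
Qed.

Lemma height_under s :
  size s = n -> path slow 0 s -> mkseq (height (under s)) n = s.
Proof.
move=> sz_s slow_s; apply: (@eq_from_nth _ 0); rewrite size_mkseq //.
move=> p lt_pn; rewrite nth_mkseq //.
have clU := under_closed sz_s slow_s.
have le_hp := height_le (under s) p; have le_sp := slow_nth_le p slow_s.
have lt_h i : i <= p -> (i < height (under s) p) = (i < nth 0 s p).
  by move=> le_ip; rewrite lt_height ?mem_under ?le_ip.
(* If the two heights differed, [lt_h] at the smaller one, which is at most [p], would be
   contradictory. *)
apply/eqP; rewrite eqn_leq; apply/andP; split; rewrite leqNgt; apply/negP=> lt.
  by have := lt_h (nth 0 s p); rewrite -ltnS lt ltnn (leq_trans lt) // => /(_ isT).
have := lt_h (height (under s) p).
by rewrite -ltnS lt ltnn (leq_trans lt) // => /(_ isT).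
Qed.

(** Taking heights is a bijection onto the slow sequences, with inverse [under]. *)
Lemma card_triangle_closed (F : {set {set T}}) :
    (forall I, reflect (triangle_closed I) (I \in F)) ->
  #|F| = size (slow_seqs n 0).
Proof.
move=> inF.
pose S := [seq mkseq (height J) n | J <- enum F].
have <- : size S = #|F| by rewrite size_map cardE.
have uS : uniq S.
  rewrite map_inj_in_uniq ?enum_uniq // => I J; rewrite !mem_enum => /inF clI.
  by move=> /inF clJ; apply: height_inj.
apply/eqP; rewrite -uniq_size_uniq ?slow_seqs_uniq // => s.
rewrite mem_slow_seqs; apply/andP/mapP => [[/eqP sz_s slow_s]|[I]].
  exists (under s); last by rewrite height_under.
  by rewrite mem_enum; apply/inF/under_closed.
rewrite mem_enum => /inF clI ->.
by rewrite size_mkseq height_slow.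
Qed.

End Triangle.

(** * Coordinates on a D-vine *)

Section Consec.
Variable T : finType.
Implicit Types q : seq T.

Definition consec q : seq {set T} :=
  if q is x :: p then pairmap (fun y z => [set y; z]) x p else [::].

Lemma size_consec q : size (consec q) = (size q).-1.
Proof. by case: q => //= x p; rewrite size_pairmap. Qed.

Lemma nth_consec x0 q j : j.+1 < size q ->
  nth set0 (consec q) j = [set nth x0 q j; nth x0 q j.+1].
Proof. by case: q => //= x p lt_jp; rewrite (nth_pairmap x0). Qed.

Lemma mem_nth_consec x0 q j k : uniq q -> j.+1 < size q -> k < size q ->
  (nth x0 q k \in nth set0 (consec q) j) = (k == j) || (k == j.+1).
Proof.
move=> uq lt_jq lt_kq.
by rewrite (nth_consec x0) // !inE !nth_uniq // (ltnW lt_jq).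
Qed.

(** If edges j and k coincide, vertices j and j+1 both lie in {k, k+1}, whence j = k. *)
Lemma consec_uniq q : uniq q -> uniq (consec q).
Proof.
case: q => [|x0 p] // uq; set q := x0 :: p in uq *.
apply/(uniqP set0) => j k; rewrite !inE size_consec !ltn_predRL => lt_j lt_k.
move/setP=> eq_jk; have := eq_jk (nth x0 q j); have := eq_jk (nth x0 q j.+1).
by rewrite !mem_nth_consec ?(ltnW lt_j) // !eqxx ?orbT; lia.
Qed.

Lemma card_set_seq q : uniq q -> #|[set:: q]| = size q.
Proof. by move=> uq; rewrite cardsE; apply/card_uniqP. Qed.

End Consec.

Section DVine.
Context {d : Order.disp_t} (T : finPOrderType d).
Variables (rk : T -> nat) (x0 : T).
Implicit Types v w x y : T.
Hypothesis rk_D : is_D_vine rk.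

Let rk_rank : is_rank_function rk.
Proof. by case: rk_D => -[[]]. Qed.

Let rk_gt0 x : 0 < rk x.
Proof. by case: rk_rank. Qed.

Let rk_lt x y : (x < y)%O -> rk x < rk y.
Proof. by case: rk_rank => _ + _ _; apply. Qed.

Let rk_covers x y : covers y x -> rk y = (rk x).+1.
Proof. by case: rk_rank => _ _ + _; apply. Qed.

Let rk_minimal x : minimal x -> rk x = 1.
Proof. by case: rk_rank => _ _ _; apply. Qed.

Let card_covered_by v : ~~ minimal v -> #|covered_by v| = 2.
Proof. by case: rk_D => -[[_ + _ _] _ _ _] _; apply. Qed.

Let poset_rankE : poset_rank rk = dimension T.
Proof. by case: rk_D => -[]. Qed.

Let level_path i : 0 < i <= dimension T ->
  is_path_graph (level rk i) (forest_edges rk i).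
Proof. by rewrite -poset_rankE; case: rk_D => _; apply. Qed.

(** A non-minimal element covers some element, whose rank is positive, so its own rank is at least
    2. *)
Lemma minimal_rk x : minimal x = (rk x == 1).
Proof.
apply/idP/eqP => [/rk_minimal //|rk1]; apply: contraPT rk1 => /card_covered_by.
move/eqP/cards2P => [y [z [_ cov]]].
have /rk_covers -> : covers x y by have := set21 y z; rewrite -cov inE.
by case => rk0; have := rk_gt0 y; rewrite rk0.
Qed.

(** The shared pair consists of distinct elements of equal rank, and in a vine at most one element
    covers both. *)
Lemma covered_by_inj v w : ~~ minimal v -> covered_by v = covered_by w -> v = w.
Proof.
move=> /card_covered_by/eqP/cards2P[x [y [neq_xy cov_v]]] cov_w.
have [cvx cvy] : covers v x /\ covers v y.
  by have := set21 x y; have := set22 x y; rewrite -cov_v !inE.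
have [cwx cwy] : covers w x /\ covers w y.
  by have := set21 x y; have := set22 x y; rewrite -cov_v cov_w !inE.
case: rk_D => -[[_ _ /(_ x y neq_xy) inj _] _ _ _] _.
apply: inj => //.
by apply: succn_inj; rewrite -(rk_covers cvx) -(rk_covers cvy).
Qed.

(** Inverts [covered_by] on edges; [x0] is a junk value for all other sets. *)
Definition cover_of (E : {set T}) : T :=
  odflt x0 [pick v | covered_by v == E].

Lemma cover_ofK v : ~~ minimal v -> cover_of (covered_by v) = v.
Proof.
move=> nmin_v; rewrite /cover_of; case: pickP => [w /eqP eq_wv|/(_ v)] /=.
  by apply/esym/covered_by_inj.
by rewrite eqxx.
Qed.

(** The path F_i together with a chosen direction. *)
Definition ordering i (q : seq T) : Prop :=
  [/\ uniq q, level rk i = [set:: q] & forest_edges rk i = [set:: consec q]].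

Lemma covered_by_cover_of i q E : 0 < i -> ordering i q -> E \in consec q ->
  covered_by (cover_of E) = E /\ rk (cover_of E) = i.+1.
Proof.
move=> i_gt0 [_ _ defE] Eq; have : E \in forest_edges rk i by rewrite defE inE.
case/imsetP => v; rewrite inE => /eqP rk_v ->.
by rewrite cover_ofK // minimal_rk rk_v; case: (i) i_gt0.
Qed.

(* By proximity, adjacent elements of level [i.+1] are consecutive pairs of the
   path [q]; both levels being paths, comparing numbers of edges shows that
   every two successive pairs of [q] are adjacent. *)
Lemma ordering_next i q : 0 < i < dimension T -> ordering i q ->
  ordering i.+1 [seq cover_of E | E <- consec q].
Proof.
move=> /andP[i_gt0 lt_in] ord_q; have [uq lvl_q edges_q] := ord_q.
have coverK := covered_by_cover_of i_gt0 ord_q.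
set q' := map _ _.
have uq' : uniq q'.
  rewrite map_inj_in_uniq ?consec_uniq // => E E' /coverK[EK _] /coverK[EK' _] eq.
  by rewrite -EK eq EK'.
have lvl_q' : level rk i.+1 = [set:: q'].
  apply/setP => v; rewrite !inE; apply/eqP/mapP => [rk_v|[E Eq ->]].
    exists (covered_by v); last first.
      by rewrite cover_ofK // minimal_rk rk_v; case: (i) i_gt0.
    suff : covered_by v \in forest_edges rk i by rewrite edges_q inE.
    by apply/imsetP; exists v; rewrite // inE rk_v.
  by have [] := coverK E Eq.
split=> //; apply/eqP; rewrite eqEcard; apply/andP; split; last first.
  have [x [p [uxp lvl_xp ->]]] : is_path_graph (level rk i.+1) (forest_edges rk i.+1).
    by apply: level_path; rewrite lt_in.
  rewrite -[pairmap _ _ _]/(consec (x :: p)) !card_set_seq ?consec_uniq //.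
  rewrite !size_consec -(card_set_seq uxp) -(card_set_seq uq').
  by rewrite -lvl_q' lvl_xp.
apply/subsetP => _ /imsetP[v + ->]; rewrite !inE => /eqP rk_v.
have nmin_v : ~~ minimal v by rewrite minimal_rk rk_v; case: (i) i_gt0.
have /eqP/cards2P[x [y [neq_xy cov_v]]] := card_covered_by nmin_v.
have [cvx cvy] : covers v x /\ covers v y.
  by have := set21 x y; have := set22 x y; rewrite -cov_v !inE.
have [rk_x rk_y] : rk x = i.+1 /\ rk y = i.+1.
  by have [] := (rk_covers cvx, rk_covers cvy); rewrite rk_v => -[->] [->].
have [w /andP[cxw cyw]] : exists w, covers x w && covers y w.
  case: rk_D => -[_ _ _ + _]; apply => //; rewrite ?rk_x ?rk_y //.
  by exists v; rewrite cvx.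
have inq' z : rk z = i.+1 -> exists j,
    [/\ j.+1 < size q, z = nth x0 q' j & covered_by z = nth set0 (consec q) j].
  move=> /eqP rk_z; have zq' : z \in q'.
    by have /setP/(_ z) := lvl_q'; rewrite !inE rk_z.
  have := zq'; rewrite -index_mem size_map size_consec ltn_predRL => lt_z.
  exists (index z q'); rewrite nth_index //; split=> //.
  have lt_z' : index z q' < size (consec q) by rewrite size_consec ltn_predRL.
  rewrite -[in LHS](nth_index x0 zq') (nth_map set0) //.
  by have [] := coverK _ (mem_nth set0 lt_z').
have [j [lt_j def_x cov_x]] := inq' x rk_x.
have [k [lt_k def_y cov_y]] := inq' y rk_y.
have wq : w \in q.
  have : w \in level rk i by rewrite inE -eqSS -rk_x (rk_covers cxw).
  by rewrite lvl_q inE.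
have lt_w : index w q < size q by rewrite index_mem.
have : w \in covered_by x by rewrite inE.
have : w \in covered_by y by rewrite inE.
(* The position of [w] in [q] lies in {j, j+1} and in {k, k+1}; since j and k differ, they are
   consecutive. *)
rewrite cov_x cov_y -(nth_index x0 wq) !mem_nth_consec // => wk wj.
have neq_jk : j != k by apply: contraNneq neq_xy => eq_jk; rewrite def_x eq_jk -def_y.
have sz_q' : size q' = (size q).-1 by rewrite size_map size_consec.
rewrite cov_v def_x def_y.
have [def_k|def_j] : k = j.+1 \/ j = k.+1 by lia.
  have lt_q' : j.+1 < size q' by rewrite sz_q' ltn_predRL -def_k.
  by rewrite def_k -(nth_consec x0) // mem_nth // size_consec ltn_predRL lt_q'.
have lt_q' : k.+1 < size q' by rewrite sz_q' ltn_predRL -def_j.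
by rewrite def_j setUC -(nth_consec x0) // mem_nth // size_consec ltn_predRL lt_q'.
Qed.

(** * Ideals through the covering relation *)

Lemma below_cover x y : (y < x)%O -> exists2 w, covers x w & (y <= w)%O.
Proof.
move=> lt_yx.
have Py : (y <= y)%O && (y < x)%O by rewrite Order.POrderTheory.lexx.
(* An element of maximal rank among those above [y] and strictly below [x] is covered by [x]. *)
have [w /andP[le_yw lt_wx] w_max] :=
  @arg_maxnP _ y (fun w => (y <= w)%O && (w < x)%O) rk Py.
exists w => //; rewrite /covers lt_wx; apply/forallP => z.
apply/negP => /andP[lt_wz lt_zx]; have := w_max z; rewrite lt_zx andbT.
rewrite (Order.POrderTheory.le_trans le_yw (Order.POrderTheory.ltW lt_wz)).
by move=> /(_ isT) /=; rewrite leqNgt rk_lt.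
Qed.

Lemma ideal_covers (A : {set T}) :
  reflect (forall x y, x \in A -> covers x y -> y \in A) (is_ideal A).
Proof.
apply: (iffP idP) => [/forallP idA x y xA /andP[lt_yx _]|clA].
  have /implyP/(_ xA)/forallP/(_ y)/implyP := idA x; apply.
  exact: Order.POrderTheory.ltW.
apply/forallP => x; apply/implyP => xA; apply/forallP => y; apply/implyP.
have [m] := ubnP (rk x); elim: m x xA => // m IHm x xA lt_xm.
rewrite Order.POrderTheory.le_eqVlt => /predU1P[-> //|/below_cover[w cxw]].
apply: IHm; first exact: clA cxw.
by rewrite -(rk_covers cxw).
Qed.

(** * The triangle of coordinates *)

Variable q0 : seq T.
Hypothesis ord_q0 : ordering 1 q0.

Definition row i : seq T :=
  iter i (fun q => [seq cover_of E | E <- consec q]) q0.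

(** Row [i] has rank [i.+1]. The shift by [i] aligns rows: entry p-i of row i+1 is the cover of
    entries p-i and p-i+1 of row i. *)
Definition coord i p : T := nth x0 (row i) (p - i).

Lemma ordering_row i : i < dimension T -> ordering i.+1 (row i).
Proof.
elim: i => [|i IHi] //= lt_in.
by apply: ordering_next; [rewrite lt_in | apply/IHi/ltnW].
Qed.

Lemma size_row i : size (row i) = dimension T - i.
Proof.
elim: i => [|i IHi]; last by rewrite size_map size_consec IHi subnS.
have [u lvl _] := ord_q0; rewrite subn0 -(card_set_seq u) -lvl.
by apply: eq_card => x; rewrite !inE minimal_rk.
Qed.

Lemma rk_coord i p : i <= p < dimension T -> rk (coord i p) = i.+1.
Proof.
move=> lt_ip; have [|_ lvl _] := @ordering_row i; first lia.
have : coord i p \in level rk i.+1 by rewrite lvl inE mem_nth // size_row; lia.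
by rewrite inE => /eqP.
Qed.

Lemma coord_inj i p i' p' : i <= p < dimension T -> i' <= p' < dimension T ->
  coord i p = coord i' p' -> i = i' /\ p = p'.
Proof.
move=> lt_ip lt_ip' eq_e; have := rk_coord lt_ip.
rewrite eq_e rk_coord // => -[def_i]; subst i'; split=> //.
have [|u _ _] := @ordering_row i; first lia.
move/eqP: eq_e; rewrite nth_uniq // ?size_row; lia.
Qed.

Lemma coord_surj x : exists i p, i <= p < dimension T /\ x = coord i p.
Proof.
have := rk_gt0 x; case rk_x: (rk x) => [|i] // _.
have lt_in : i < dimension T by rewrite -rk_x -poset_rankE leq_bigmax.
have [_ lvl _] := ordering_row lt_in.
have xq : x \in row i by have /setP/(_ x) := lvl; rewrite !inE rk_x eqxx.
exists i, (i + index x (row i)); rewrite /coord addKn nth_index //; split=> //.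
by move: xq; rewrite -index_mem size_row; lia.
Qed.

Lemma covers_coord i p y : i <= p -> p.+1 < dimension T ->
  covers (coord i.+1 p.+1) y = (y == coord i p) || (y == coord i p.+1).
Proof.
move=> le_ip lt_pn; have [|u _ _] := @ordering_row i; first lia.
have sz := size_row i.
have lt_c : p - i < size (consec (row i)) by rewrite size_consec sz; lia.
have -> : covers (coord i.+1 p.+1) y = (y \in covered_by (coord i.+1 p.+1)).
  by rewrite inE.
rewrite /coord subSS /= (nth_map set0) //.
have [|-> _] := @covered_by_cover_of i.+1 (row i) _ isT _ (mem_nth set0 lt_c).
  by apply: ordering_row; lia.
by rewrite (nth_consec x0) ?sz ?subSn ?inE //; lia.
Qed.

Lemma card_ideals_D_vine : #|ideals T| = size (slow_seqs (dimension T) 0).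
Proof.
apply: (card_triangle_closed coord_inj coord_surj) => A; rewrite inE.
apply: (iffP (ideal_covers A)) => clA.
  move=> i p le_ip lt_pn eA.
  by rewrite !(clA _ _ eA) // covers_coord // eqxx ?orbT.
move=> x y + cxy; have [[|i] [[|p] [lt_ip def_x]]] := coord_surj x => //.
(* Row 0 has rank 1, so its elements cover nothing. *)
- by have := rk_gt0 y; have := rk_covers cxy; rewrite def_x rk_coord // => -[<-].
- by have := rk_gt0 y; have := rk_covers cxy; rewrite def_x rk_coord // => -[<-].
move/andP: lt_ip => [le_ip lt_pn]; rewrite def_x => eA.
have /andP[eA1 eA2] := clA i p le_ip lt_pn eA.
by move: cxy; rewrite def_x covers_coord // => /orP[] /eqP->.
Qed.

End DVine.

(** * The product formula *)

Section CatalanProduct.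
Import GRing.Theory Num.Theory.
Local Open Scope ring_scope.

Lemma prod_bin (l m : nat) :
  \prod_(1 <= k < m.+1) ((l + k)%:R / k%:R) = 'C(l + m, m)%:R :> rat.
Proof.
elim: m => [|m IHm]; first by rewrite big_geq ?bin0.
rewrite big_nat_recr //= IHm mulrA -natrM mulnC addnS mul_bin_diag natrM.
by rewrite mulrAC mulfV ?mul1r ?pnatr_eq0.
Qed.

(** For m = l the product in [prod_bin] is C(2l, l), and its factor at k = 1 is l+1, which cancels
    the denominator. *)
Lemma catalan_prod (l : nat) : (0 < l)%N ->
  catalan l = \prod_(2 <= k < l.+1) ((l + k)%:R / k%:R).
Proof.
move=> l_gt0; rewrite /catalan mul2n -addnn -prod_bin big_ltn // addn1 mulrA.
by rewrite divr1 mul1r mulVf ?mul1r ?pnatr_eq0.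
Qed.
End CatalanProduct.

Local Open Scope ring_scope.

Theorem theorem7p10 (l : nat) (hl : (2 <= l)%N)
    (d : Order.disp_t) (T : finPOrderType d) (rk : T -> nat)
    (hD : is_D_vine rk) (hdim : dimension T = (l - 1)%N) :
  #|ideals T|%:R = catalan l /\
  catalan l = \prod_(2 <= k < l.+1) ((l + k)%:R / k%:R).
Proof.
split; last by apply: catalan_prod; lia.
have [x0 [p [u lvl edges]]] : is_path_graph (level rk 1) (forest_edges rk 1).
  by case: hD => -[_ rkE _ _]; apply; rewrite rkE hdim; lia.
have ord_q0 : ordering rk 1 (x0 :: p) by split.
rewrite (card_ideals_D_vine x0 hD ord_q0) hdim.
(* Dimension l-1 turns the count into (l+1) * count = C(2l, l), to be divided by l+1 in [rat]. *)
have := size_slow_seqs_catalan (l - 1).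
have -> : (l - 1).+1 = l by lia.
move/(congr1 (fun m : nat => m%:R : rat)); rewrite GRing.natrM /catalan => <-.
by rewrite GRing.mul1r GRing.mulKf // Num.Theory.pnatr_eq0.
Qed.
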